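(* For each pair of integers $p\ge 2$, $n\ge 2$ let $L_1,\ldots,L_p$ be arbitrary deterministic unit vectors in $\mathbb{R}^n$ (the choice may depend on $p$ and $n$), let $U$ be a random vector uniformly distributed on the unit sphere $S^{n-1}\subset\mathbb{R}^n$, and put $M_{p,n}=\max_{1\le j\le p}|\langle L_j,U\rangle|$. Then: (i) for every $\delta>0$, $$\mathbb{P}\Big(M_{p,n}>\sqrt{(1+\delta)(1-p^{-2/(n-1)})}\Big)\le \frac{\sqrt{2}\,p^{1/(n-1)}\exp\!\big(-\tfrac12\delta(n-1)(p^{2/(n-1)}-1)\big)}{\sqrt{\pi(1+\delta)(n-1)(p^{2/(n-1)}-1)}};$$ (ii) consequently, for every $\delta>0$, as $p\to\infty$, $$\sup_{n\ge 2}\ \mathbb{P}\Big(M_{p,n}>\sqrt{(1+\delta)(1-p^{-2/(n-1)})}\Big)\to 0;$$ (iii) in particular, if also $n\to\infty$, then one has the double limit $$\lim_{p,n\to\infty}\mathbb{P}\Big(M_{p,n}\le\sqrt{1-p^{-2/(n-1)}}\Big)=1.$$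
   Context: $S^{n-1}$ is the unit sphere of $\mathbb{R}^n$ with its Euclidean inner product $\langle\cdot,\cdot\rangle$; ''uniformly distributed'' means with respect to normalized surface measure. The notation $\lim_{p,n\to\infty}$ denotes the double limit as $p$ and $n$ tend to infinity jointly, with no restriction on their relative rates. *)

(* Defs.v *)
From HB Require Import structures.
From mathcomp Require Import all_boot all_order all_algebra.
From mathcomp Require Import all_classical all_reals all_analysis.

Set Implicit Arguments.
Unset Strict Implicit.
Unset Printing Implicit Defensive.

Import Order.TTheory GRing.Theory Num.Theory.
Import numFieldNormedType.Exports.

Local Open Scope classical_set_scope.
Local Open Scope ring_scope.

(* R^n is n.-tuple R, the type which the library equips with the product
   (Borel) sigma-algebra.  The norm that the library puts on row vectors is the
   sup norm, hence the Euclidean structure below. *)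

Definition dot (R : realType) (n : nat) (x y : n.-tuple R) : R :=
  \sum_(i < n) tnth x i * tnth y i.

Definition enorm (R : realType) (n : nat) (x : n.-tuple R) : R :=
  Num.sqrt (dot x x).

(* S^(n-1) *)
Definition sphere (R : realType) (n : nat) : set (n.-tuple R) :=
  [set x | enorm x = 1].

(* n-dimensional Lebesgue measure: the n-fold product of the Lebesgue measure
   on R, transported along R * R^n -> R^n.+1. *)
Fixpoint lebesgue_tuple (R : realType) (n : nat) : set (n.-tuple R) -> \bar R :=
  match n with
  | 0 => \d_ [tuple]
  | m.+1 => pushforward (@lebesgue_measure R \x @lebesgue_tuple R m)%E
              (fun z : R * m.-tuple R => [tuple of z.1 :: z.2])
  end.

Definition solid_cone (R : realType) (n : nat) (A : set (n.-tuple R)) :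
    set (n.-tuple R) :=
  [set x | exists r : R, exists2 u : n.-tuple R,
     0 < r <= 1 /\ A u & x = [tuple r * tnth u i | i < n]].

(* Surface measure of the part of A lying on the sphere, defined from the
   Lebesgue measure m through polar coordinates as
   sigma(E) = n * m {r u | 0 < r <= 1, u in E}. *)
Definition surface_measure (R : realType) (n : nat) (A : set (n.-tuple R)) :
    \bar R :=
  (n%:R%:E * lebesgue_tuple (solid_cone (A `&` @sphere R n)))%E.

Definition normalized_surface_measure (R : realType) (n : nat)
    (A : set (n.-tuple R)) : \bar R :=
  (surface_measure A / surface_measure (@sphere R n))%E.

Definition uniform_on_sphere (R : realType) (n : nat) (d : measure_display)
    (T : measurableType d) (P : probability T R)
    (U : {RV P >-> n.-tuple R}) : Prop :=
  forall A : set (n.-tuple R), measurable A ->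
    distribution P U A = normalized_surface_measure A.

(* max_(j < p) |<L_j, u>|; the default value 0 is harmless, the terms being
   nonnegative. *)
Definition max_abs_dot (R : realType) (p n : nat) (L : 'I_p -> n.-tuple R)
    (u : n.-tuple R) : R :=
  \big[Num.max/0]_(j < p) `|dot (L j) u|.

(* Main.v *)
(* Polar coordinates turn the probability of the cap {<v, u> > t} into the
   Lebesgue measure of a solid cone inside the unit ball.  Lebesgue measure is
   rotation invariant, so v may be taken to be the first basis vector, and
   slicing along that axis bounds the cone in dimension N by
   V_(N-1) (1 - t^2)^((N-1)/2) / (t N).  The ball itself has volume
   V_(N-1) C_N where C_k is the integral of cos^k over [-pi/2, pi/2], and the
   Wallis relation (k+1) C_(k+1) C_k = 2 pi gives
   N C_N >= sqrt (2 pi (N-1)).  The caps of the 2p vectors +-L_j are then summed;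
   with w = p^(1/(N-1)) and t^2 = (1 + delta) (1 - w^-2) one has
   1 - t^2 = (1 - delta (w^2 - 1)) / w^2 <= exp (- delta (w^2 - 1)) / w^2, whose
   power (N-1)/2 cancels the factor p = w^(N-1).  The estimate holds for
   delta = 0 too, which gives (iii). *)

Require Import Defs.
From HB Require Import structures.
From mathcomp Require Import all_boot all_order all_algebra.
From mathcomp Require Import all_classical all_reals all_analysis.
From mathcomp Require Import measurable_realfun.
From mathcomp Require Import zify ring lra.

Set Implicit Arguments.
Unset Strict Implicit.
Unset Printing Implicit Defensive.

Import Order.TTheory GRing.Theory Num.Theory.
Import numFieldNormedType.Exports.

Local Open Scope classical_set_scope.
Local Open Scope ring_scope.

(** * Wallis integrals of powers of the cosine *)

Section wallis.
Context {R : realType}.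
Implicit Types (k : nat) (r x : R).
Local Notation mu := (@lebesgue_measure R).
Local Notation I := `[- (pi / 2 : R), pi / 2].

Lemma integral_is_derive (f F : R -> R) a b : a < b -> continuous f ->
  (forall x, is_derive x 1 F (f x)) ->
  (\int[mu]_(x in `[a, b]) (f x)%:E = (F b)%:E - (F a)%:E)%E.
Proof.
move=> ab cf dF; apply: continuous_FTC2 => //.
- exact: continuous_subspaceT.
- have cF : continuous F.
    move=> x; apply: differentiable_continuous.
    by apply/derivable1_diffP; exact: ex_derive.
  split => [x _||]; first exact: ex_derive.
    exact/cvg_at_right_filter/cF.
  exact/cvg_at_left_filter/cF.
- by move=> x _; rewrite derive1E; apply: derive_val.
Qed.

Let ltNpp : - (pi / 2) < pi / 2 :> R.
Proof. by rewrite gtrN// divr_gt0// pi_gt0. Qed.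

(** For k at least 1 this number is also the ratio of the volumes of the unit balls in dimensions k
    and k - 1. *)
Definition cos_int k : R := \int[mu]_(x in [set` I]) cos x ^+ k.

Lemma continuous_cosX k : continuous (fun x : R => cos x ^+ k).
Proof.
move=> x; apply: (@continuous_comp _ _ _ cos (fun y : R => y ^+ k)).
  exact: continuous_cos.
exact: exprn_continuous.
Qed.

Lemma integrable_cosX k : mu.-integrable [set` I] (EFin \o (fun x => cos x ^+ k)).
Proof.
apply: continuous_compact_integrable; first exact: segment_compact.
by apply: continuous_subspaceT; exact: continuous_cosX.
Qed.

Lemma integral_cosX k :
  (\int[mu]_(x in [set` I]) (cos x ^+ k)%:E = (cos_int k)%:E)%E.
Proof.
by rewrite /cos_int /Rintegral fineK// integrable_fin_num//; exact: integrable_cosX.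
Qed.

Lemma cos_ge0_I x : x \in I -> 0 <= cos x.
Proof. by rewrite in_itv/= => /cos_ge0_pihalf. Qed.

Lemma cos_int_ge0 k : 0 <= cos_int k.
Proof. by apply: Rintegral_ge0 => x /= xI; rewrite exprn_ge0// cos_ge0_I. Qed.

Lemma cos_int_le k : cos_int k.+1 <= cos_int k.
Proof.
apply: le_Rintegral => //=.
- exact: integrable_cosX.
- exact: integrable_cosX.
- move=> x xI; rewrite exprS ler_piMl ?cos_le1//.
  by rewrite exprn_ge0// cos_ge0_I.
Qed.

(** The function sin cos^(k+1) has derivative (k+2) cos^(k+2) - (k+1) cos^k and vanishes at both
    endpoints, so this derivative integrates to zero. *)
Lemma cos_intSS k : k.+2%:R * cos_int k.+2 = k.+1%:R * cos_int k.
Proof.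
pose F := (@sin R) * ((@cos R) ^+ k.+1).
pose f x : R := k.+2%:R * cos x ^+ k.+2 - k.+1%:R * cos x ^+ k.
have dF x : is_derive x 1 F (f x).
  apply: is_derive_eq.
  rewrite /f /GRing.scale/= exprfctE !exprS.
  have := cos2Dsin2 x; rewrite -[k.+2%:R]natr1.
  move: (sin x) (cos x) => s c sc.
  have ss : s * s = 1 - c * c by rewrite -!expr2 -sc addrAC subrr add0r.
  transitivity (- (s * s) * (k.+1%:R * c ^+ k) + c * c * c ^+ k); first ring.
  by rewrite ss; ring.
have cf : continuous f.
  by move=> x; apply: cvgB; apply: cvgMr; exact: continuous_cosX.
have : (\int[mu]_(x in [set` I]) (f x)%:E = (F (pi / 2))%:E - (F (- (pi / 2)))%:E)%E.
  exact: integral_is_derive.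
rewrite /F /= !fctE cosN cos_pihalf !expr0n !mulr0 subee//.
rewrite /f; under eq_integral do rewrite EFinB (EFinM k.+2%:R) (EFinM k.+1%:R).
rewrite integralB//=; last 2 first.
- by apply: integrableZl => //; exact: integrable_cosX.
- by apply: integrableZl => //; exact: integrable_cosX.
rewrite !integralZl//; [|exact: integrable_cosX..].
rewrite !integral_cosX -!EFinM -EFinB => -[] /eqP.
by rewrite subr_eq0 => /eqP.
Qed.

Lemma cos_int0 : cos_int 0 = pi.
Proof.
rewrite /cos_int; under eq_Rintegral do rewrite expr0.
rewrite Rintegral_cst//= lebesgue_measure_itv/= lte_fin ltNpp/=.
by rewrite mul1r opprK -splitr.
Qed.

Lemma cos_int1 : cos_int 1 = 2.
Proof.
apply: EFin_inj; rewrite -integral_cosX.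
rewrite (@integral_is_derive _ sin)//; last exact: continuous_cosX.
by rewrite sinN sin_pihalf -EFinB opprK.
Qed.

(** By the recurrence the product does not depend on k, and its value at k = 0 is 2 times pi. *)
Lemma cos_int_prod k : k.+1%:R * cos_int k.+1 * cos_int k = 2 * pi.
Proof.
elim: k => [|k IH]; first by rewrite cos_int0 cos_int1 mul1r.
by rewrite cos_intSS -IH mulrAC.
Qed.

Lemma cos_int_gt0 k : 0 < cos_int k.
Proof.
rewrite lt_neqAle cos_int_ge0 andbT eq_sym; apply/negP => /eqP C0.
have := cos_int_prod k; rewrite C0 mulr0 => /esym/eqP.
by rewrite mulf_eq0 pnatr_eq0/= gt_eqF// pi_gt0.
Qed.

(** Since C_k is nonincreasing, the product formula at n + 1 gives 2 pi <= (n+2) C_(n+1)^2; it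
    remains to use n (n+2) <= (n+1)^2. *)
Lemma cos_int_lb n : 2 * pi * n%:R <= (n.+1%:R * cos_int n.+1) ^+ 2.
Proof.
have C := cos_int_gt0 n.+1.
have E : 2 * pi <= n.+2%:R * cos_int n.+1 ^+ 2 :> R.
  by rewrite -(cos_int_prod n.+1) expr2 mulrA ler_pM2r// ler_pM2l ?cos_int_le.
have N : n.+2%:R * n%:R <= n.+1%:R ^+ 2 :> R.
  by rewrite -natrM -natrX ler_nat; lia.
rewrite exprMn (le_trans (ler_wpM2r _ E))// mulrAC.
by rewrite ler_wpM2r// sqr_ge0.
Qed.

Lemma continuous_sqrt_sqrB r n :
  continuous (fun x : R => Num.sqrt (r ^+ 2 - x ^+ 2) ^+ n).
Proof.
move=> x.
apply: (@continuous_comp _ _ _ (fun y : R => Num.sqrt (r ^+ 2 - y ^+ 2))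
  (fun y : R => y ^+ n)); last exact: exprn_continuous.
apply: (@continuous_comp _ _ _ (fun y : R => r ^+ 2 - y ^+ 2) (@Num.sqrt R)).
  by apply: cvgB; [exact: cvg_cst|exact: exprn_continuous].
exact: sqrt_continuous.
Qed.

(** The substitution x = r sin(theta) turns the integral into that of r^(n+1) cos^(n+1). It yields
    the volume of a ball from its slices. *)
Lemma integral_sqrt_sqrB r n : 0 <= r ->
  (\int[mu]_(x in `[(- r)%R, r]) (Num.sqrt (r ^+ 2 - x ^+ 2) ^+ n)%:E =
   (r ^+ n.+1 * cos_int n.+1)%:E)%E.
Proof.
(* Radius zero is set apart: the substitution needs r sin to be strictly increasing. *)
rewrite le_eqVlt => /predU1P[<-|r0].
  by rewrite oppr0 set_itv1 integral_set1 expr0n/= mul0r.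
pose F (x : R) : R := r * sin x.
have dF (x : R) : is_derive x 1 F (r * cos x).
  exact: (@is_deriveZ _ _ _ (@sin R) r x 1 (cos x)).
have F'E : (derive1 F) = (fun x => r * cos x).
  by apply/funext => x; rewrite derive1E; apply: derive_val.
have FN : F (- (pi / 2)) = - r by rewrite /F/= sinN sin_pihalf mulrN mulr1.
have FP : F (pi / 2) = r by rewrite /F/= sin_pihalf mulr1.
have cF' : continuous (derive1 F).
  by rewrite F'E => x; apply: cvgMr; exact: continuous_cos.
have cF : continuous F.
  by move=> x; apply: cvgMr; exact: continuous_sin.
rewrite -[X in `[X, _]]FN -[X in `[_, X]]FP.
rewrite integration_by_substitution_increasing//.
- transitivity (\int[mu]_(x in [set` I]) ((r ^+ n.+1)%:E * (cos x ^+ n.+1)%:E))%E.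
    apply: eq_integral => x /[!inE] xI; rewrite -EFinM; congr EFin.
    rewrite !fctE F'E/= /F/=.
    rewrite exprMn -[X in X - _]mulr1 -mulrBr -cos2sin2 -exprMn.
    rewrite sqrtr_sqr ger0_norm ?mulr_ge0 ?(ltW r0) ?cos_ge0_I//.
    by rewrite -exprSr exprMn.
  rewrite integralZl//; last exact: integrable_cosX.
  by rewrite integral_cosX.
- exact: ltW.
- move=> x y xI yI xy; rewrite /F ltr_pM2l//.
  by rewrite ltr_sin.
- apply/cvg_ex; exists (derive1 F (- (pi / 2))); exact/cvg_at_right_filter/cF'.
- apply/cvg_ex; exists (derive1 F (pi / 2)); exact/cvg_at_left_filter/cF'.
- split => [x _||].
    by have [] := dF x.
    exact/cvg_at_right_filter/cF.
  exact/cvg_at_left_filter/cF.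
- apply: continuous_subspaceT => x.
  exact: continuous_sqrt_sqrB.
Qed.

End wallis.

(** * Lebesgue measure on tuples as a sigma-finite measure *)

Section lebesgue_tuple_measure.
Context {R : realType}.
Implicit Types n : nat.
Local Notation mu := (@lebesgue_measure R).

Lemma measurable_cons_tuple n :
  measurable_fun [set: R * n.-tuple R] (fun z => [tuple of z.1 :: z.2]).
Proof. exact: measurable_cons. Qed.

(** The induction carries sigma-finiteness along with additivity, because the product with one more
    line uses both. The existential form lets the structures be attached afterwards to the recursive
    function itself. *)
Lemma lebesgue_tuple_is_measure n :
  exists m : {sigma_finite_measure set (n.-tuple R) -> \bar R},
    (m : set _ -> \bar R) = @lebesgue_tuple R n.
Proof.
elim: n => [|n [m mE]]; first by exists (\d_ [tuple]).
pose f (z : R * n.-tuple R) := [tuple of z.1 :: z.2].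
have mf : measurable_fun [set: R * n.-tuple R] f := @measurable_cons_tuple n.
pose m0 : {measure set (n.+1.-tuple R) -> \bar R} := pushforward (mu \x m)%E f.
pose m' := m0 mf.
have sm' : sigma_finite setT m'.
  have /sigma_finiteP[F [FT ndF Foo]] := sigma_finiteT mu.
  have /sigma_finiteP[G [GT ndG Goo]] := sigma_finiteT m.
  pose g (x : n.+1.-tuple R) := (thead x, [tuple of behead x]).
  have mg : measurable_fun setT g.
    apply/measurable_fun_pair; [exact: measurable_tnth|exact: measurable_behead].
  have fgK : f \; g = id.
    by apply/funext => -[x y]; rewrite /g /= theadE; congr pair; apply/val_inj.
  (* The exhaustion is made of products pulled back along the splitting map [g]. Both sequences are
     nondecreasing, so a point is caught at the larger of its two indices. *)
  exists (fun k => g @^-1` (F k `*` G k)).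
    apply/esym; rewrite -subTset => x _.
    have [i _ Fi] : (\bigcup_k F k) (g x).1 by rewrite -FT.
    have [j _ Gj] : (\bigcup_k G k) (g x).2 by rewrite -GT.
    exists (maxn i j) => //; split.
      by move: Fi; exact/subsetPset/ndF/leq_maxl.
    by move: Gj; exact/subsetPset/ndG/leq_maxr.
  move=> k; have [mF Fk] := Foo k; have [mG Gk] := Goo k; split.
    by rewrite -[X in measurable X]setTI; apply: mg => //; exact: measurableX.
  rewrite /m' /m0 /= /pushforward -comp_preimage [_ \o _]fgK.
  rewrite preimage_id product_measure1E//.
  by rewrite lte_mul_pinfty// ge0_fin_numE.
pose H1 := isSFinite.Build _ _ _ _ (sfinite_measure_sigma_finite sm').
pose H2 := isSigmaFinite.Build _ _ _ _ sm'.
pose m'' := HB.pack_for {sigma_finite_measure set (n.+1.-tuple R) -> \bar R}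
  (Measure.sort m') H1 H2.
by exists m''; rewrite /m''/= /m' /m0 /= mE.
Qed.

Let lebesgue_tuple0 n : @lebesgue_tuple R n set0 = 0%E.
Proof. by have [m <-] := lebesgue_tuple_is_measure n. Qed.

Let lebesgue_tuple_ge0 n A : (0 <= @lebesgue_tuple R n A)%E.
Proof. by have [m <-] := lebesgue_tuple_is_measure n. Qed.

Let lebesgue_tuple_sigma_additive n : semi_sigma_additive (@lebesgue_tuple R n).
Proof.
by have [m <-] := lebesgue_tuple_is_measure n; exact: measure_semi_sigma_additive.
Qed.

HB.instance Definition _ n := isMeasure.Build _ _ _ (@lebesgue_tuple R n)
  (@lebesgue_tuple0 n) (@lebesgue_tuple_ge0 n) (@lebesgue_tuple_sigma_additive n).

Let lebesgue_tuple_sigma_finite n : sigma_finite setT (@lebesgue_tuple R n).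
Proof. by have [m <-] := lebesgue_tuple_is_measure n; exact: sigma_finiteT. Qed.

HB.instance Definition _ n := Measure_isSigmaFinite.Build _ _ _
  (@lebesgue_tuple R n) (@lebesgue_tuple_sigma_finite n).

Lemma lebesgue_tupleS n (A : set (n.+1.-tuple R)) :
  (lebesgue_tuple A =
   \int[mu]_x lebesgue_tuple [set y : n.-tuple R | A [tuple of x :: y]])%E.
Proof.
apply: eq_integral => x _; congr lebesgue_tuple.
by apply/seteqP; split => y; rewrite xsectionP.
Qed.

End lebesgue_tuple_measure.

(** * Invariance under isometries, built from shears and reflections of coordinate planes *)

Section rotation.
Context {R : realType}.
Implicit Types (n : nat) (a b c : R).
Local Notation mu := (@lebesgue_measure R).

(** The image of Lebesgue measure under a translation agrees with it on half-open intervals, hence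
    everywhere by uniqueness. *)
Lemma ge0_integral_shift (f : R -> \bar R) c : measurable_fun [set: R] f ->
  (forall x, 0 <= f x)%E -> (\int[mu]_x f (x + c)%R = \int[mu]_x f x)%E.
Proof.
move=> mf f0; pose phi (x : R) := x + c.
have mphi : measurable_fun [set: R] phi by exact: measurable_funD.
pose pm0 : {measure set (measurableTypeR R) -> \bar R} :=
  pushforward mu (phi : _ -> measurableTypeR R).
transitivity (\int[pushforward mu (phi : _ -> measurableTypeR R)]_x f x)%E.
  by rewrite ge0_integral_pushforward//= preimage_setT.
apply: eq_measure_integral => A mA _.
apply/esym; apply: (@lebesgue_measure_unique _ (pm0 mphi)) => // _ [[x y]] _ <-.
rewrite /pm0 /= /pushforward.
have -> : phi @^-1` `]x, y] = `]x - c, y - c]%classic.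
  by apply/seteqP; split => z; rewrite /= !in_itv/= /phi ltrBlDr lerBrDr.
rewrite [RHS]lebesgue_measure_itv/= [LHS]lebesgue_measure_itv/= !lte_fin ltrD2r.
by rewrite -!EFinD opprB addrA subrK.
Qed.

Lemma ge0_integral_opp (f : R -> \bar R) : measurable_fun [set: R] f ->
  (forall x, 0 <= f x)%E -> (\int[mu]_x f (- x)%R = \int[mu]_x f x)%E.
Proof.
move=> mf f0.
transitivity (\int[pushforward mu (-%R : _ -> measurableTypeR R)]_x f x)%E.
  by rewrite ge0_integral_pushforward//= preimage_setT.
by apply: eq_measure_integral => //= A mA _; exact: lebesgue_measureN.
Qed.

Lemma integral_plane_swap (F : R * R -> \bar R) : measurable_fun setT F ->
  (forall z, 0 <= F z)%E ->
  (\int[mu]_y \int[mu]_x F (x, y) = \int[mu]_x \int[mu]_y F (x, y))%E.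
Proof.
move=> mF F0.
have := @fubini_tonelli _ _ (measurableTypeR R) (measurableTypeR R) R mu mu F mF F0.
exact/esym.
Qed.

(** Invariance is phrased with iterated integrals of nonnegative functions, not with sets: a shear
    is then a translation in the inner integral, and [F] can later be the measure of a section in
    the remaining coordinates. *)
Definition plane_preserving (g : R * R -> R * R) :=
  measurable_fun setT g /\
  forall F : R * R -> \bar R, measurable_fun setT F -> (forall z, 0 <= F z)%E ->
    (\int[mu]_x \int[mu]_y F (g (x, y)) = \int[mu]_x \int[mu]_y F (x, y))%E.

Lemma plane_preserving_comp g h :
  plane_preserving g -> plane_preserving h -> plane_preserving (g \o h).
Proof.
move=> [mg Hg] [mh Hh]; split; first exact: measurableT_comp.
move=> F mF F0; rewrite -(Hg _ mF F0).
have mFg : measurable_fun setT (F \o g) by exact: measurableT_comp.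
by apply: (Hh _ mFg) => z; exact: F0.
Qed.

Lemma plane_preserving_shear_snd a :
  plane_preserving (fun z => (z.1, z.2 + a * z.1)).
Proof.
split.
  apply/measurable_fun_pair => //=; apply: measurable_funD => //.
  exact: measurable_funM.
move=> F mF F0; apply: eq_integral => x _ /=.
apply: (@ge0_integral_shift (fun y => F (x, y))) => //.
exact: measurableT_comp.
Qed.

(** Exchanging the order of integration puts the sheared coordinate inside, where it undergoes a
    translation. *)
Lemma plane_preserving_shear_fst a :
  plane_preserving (fun z => (z.1 + a * z.2, z.2)).
Proof.
have mg : measurable_fun setT (fun z : R * R => (z.1 + a * z.2, z.2)).
  apply/measurable_fun_pair => //=; apply: measurable_funD => //.
  exact: measurable_funM.
split; first exact: mg.
move=> F mF F0; have mFg : measurable_fun setT (fun z : R * R => F (z.1 + a * z.2, z.2)).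
  exact: (measurableT_comp mF mg).
rewrite -(integral_plane_swap mF F0) -(integral_plane_swap mFg (fun z => F0 _)).
apply: eq_integral => y _ /=.
apply: (@ge0_integral_shift (fun x => F (x, y))) => //.
exact: measurableT_comp.
Qed.

Lemma plane_preserving_opp_fst : plane_preserving (fun z => (- z.1, z.2)).
Proof.
split; first by apply/measurable_fun_pair => //=; exact: measurableT_comp.
move=> F mF F0.
apply: (@ge0_integral_opp (fun x => \int[mu]_y F (x, y))%E) => //.
  exact: measurable_fun_fubini_tonelli_F.
by move=> x; exact: integral_ge0.
Qed.

(* A rotation of angle t other than pi is a product of three shears, of
   parameters tan (t / 2), sin t and tan (t / 2). *)
Lemma plane_preserving_rotation_ge0 a b : 0 <= a -> exists2 g,
  plane_preserving g & forall z,
    a * (g z).1 + b * (g z).2 = Num.sqrt (a ^+ 2 + b ^+ 2) * z.1 /\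
    (g z).1 ^+ 2 + (g z).2 ^+ 2 = z.1 ^+ 2 + z.2 ^+ 2.
Proof.
move=> a0; set r := Num.sqrt _.
have r2 : r ^+ 2 = a ^+ 2 + b ^+ 2 by rewrite sqr_sqrtr// addr_ge0// sqr_ge0.
have r0 : 0 <= r by exact: sqrtr_ge0.
have [r00|rN0] := eqVneq r 0.
  have /eqP := r2; rewrite r00 expr0n/= eq_sym paddr_eq0 ?sqr_ge0//.
  rewrite !sqrf_eq0 => /andP[/eqP-> /eqP->].
  exists id => [|z]; last by rewrite !mul0r addr0.
  by split; [exact: measurable_id|].
pose c := a / r; pose s := b / r; pose t := s / (1 + c).
have c0 : 0 <= c by exact: divr_ge0.
have c1 : 1 + c != 0 by rewrite gt_eqF// ltr_wpDr.
have cs : c ^+ 2 + s ^+ 2 = 1.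
  by rewrite !expr_div_n -mulrDl -r2 divff// expf_neq0.
have ac : a = r * c by rewrite mulrC divfK.
have bs : b = r * s by rewrite mulrC divfK.
have tc : t * (1 + c) = s by rewrite divfK.
have ts : t * s = 1 - c.
  apply: (mulIf c1); rewrite mulrAC tc.
  by transitivity (c ^+ 2 + s ^+ 2 - c ^+ 2); [ring|rewrite cs; ring].
pose S z : R * R := (z.1 + (- t) * z.2, z.2).
pose T z : R * R := (z.1, z.2 + s * z.1).
exists (S \o (T \o S)); last move=> z.
  apply: plane_preserving_comp; first exact: plane_preserving_shear_fst.
  apply: plane_preserving_comp; first exact: plane_preserving_shear_snd.
  exact: plane_preserving_shear_fst.
have -> : (S \o (T \o S)) z = (c * z.1 - s * z.2, s * z.1 + c * z.2).
  rewrite /S /T /=; congr pair.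
    transitivity ((1 - t * s) * z.1 - t * (1 + (1 - t * s)) * z.2); first ring.
    by rewrite ts subKr tc.
  transitivity (s * z.1 + (1 - t * s) * z.2); first ring.
  by rewrite ts subKr.
rewrite /= ac bs; split.
  transitivity (r * (c ^+ 2 + s ^+ 2) * z.1); first ring.
  by rewrite cs mulr1.
transitivity ((c ^+ 2 + s ^+ 2) * (z.1 ^+ 2 + z.2 ^+ 2)); first ring.
by rewrite cs mul1r.
Qed.

(** For negative a, the vector (-a, b) is aligned first and the first coordinate is then negated;
    this keeps the angle away from pi, where the half-angle tangent blows up. *)
Lemma plane_preserving_rotation a b : exists2 g,
  plane_preserving g & forall z,
    a * (g z).1 + b * (g z).2 = Num.sqrt (a ^+ 2 + b ^+ 2) * z.1 /\
    (g z).1 ^+ 2 + (g z).2 ^+ 2 = z.1 ^+ 2 + z.2 ^+ 2.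
Proof.
have [a0|a0] := leP 0 a; first exact: plane_preserving_rotation_ge0.
have [|g pg gE] := plane_preserving_rotation_ge0 (a := - a) b.
  by rewrite oppr_ge0 ltW.
exists ((fun z => (- z.1, z.2)) \o g) => [|z /=].
  exact: plane_preserving_comp plane_preserving_opp_fst pg.
by rewrite mulrN -mulNr sqrrN -[in Num.sqrt _]sqrrN; exact: gE.
Qed.

Definition tuple_preserving n (g : n.-tuple R -> n.-tuple R) :=
  measurable_fun setT g /\ forall A, measurable A ->
    lebesgue_tuple (g @^-1` A) = lebesgue_tuple A.

Lemma tuple_preserving_comp n (g h : n.-tuple R -> n.-tuple R) :
  tuple_preserving g -> tuple_preserving h -> tuple_preserving (g \o h).
Proof.
move=> [mg Hg] [mh Hh]; split; first exact: measurableT_comp.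
move=> A mA; rewrite comp_preimage Hh ?Hg//.
by rewrite -[X in measurable X]setTI; exact: mg.
Qed.

Lemma tuple_preserving_cons n (g : n.-tuple R -> n.-tuple R) :
  tuple_preserving g ->
  tuple_preserving (fun x => [tuple of thead x :: g [tuple of behead x]]).
Proof.
move=> [mg Hg]; split.
  apply: measurable_cons; first exact: measurable_tnth.
  by apply: measurableT_comp => //; exact: measurable_behead.
move=> A mA; rewrite !lebesgue_tupleS; apply: eq_integral => x _.
rewrite -[RHS]Hg; last first.
  by rewrite -[X in measurable X]setTI; apply: measurable_cons.
congr lebesgue_tuple; apply/funext => y /=; congr (A _).
by rewrite theadE; apply/val_inj => /=; congr (_ :: val (g _)); exact/val_inj.
Qed.

(** Slicing along two coordinates writes the measure of A as a double integral of [F], the measure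
    of the section of A over a point of the plane; plane invariance is then applied to [F]. *)
Lemma tuple_preserving_plane n (g : R * R -> R * R) : plane_preserving g ->
  tuple_preserving (fun x : n.+2.-tuple R =>
    let z := g (thead x, thead [tuple of behead x]) in
    [tuple of z.1 :: [tuple of z.2 :: [tuple of behead (behead x)]]]).
Proof.
move=> [mg Hg]; split.
  have mh : measurable_fun setT
      (fun x : n.+2.-tuple R => g (thead x, thead [tuple of behead x])).
    apply: measurableT_comp => //; apply/measurable_fun_pair => /=.
      exact: measurable_tnth.
    by apply: measurableT_comp; [exact: measurable_tnth|exact: measurable_behead].
  apply: measurable_cons; first exact: measurableT_comp mh.
  apply: measurable_cons; first exact: measurableT_comp mh.
  exact: (measurableT_comp (@measurable_behead _ _ n) (@measurable_behead _ _ n.+1)).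
move=> A mA.
pose F (z : R * R) := lebesgue_tuple
  [set y : n.-tuple R | A [tuple of z.1 :: [tuple of z.2 :: y]]].
have mF : measurable_fun setT F.
  pose k (w : (R * R) * n.-tuple R) :=
    [tuple of w.1.1 :: [tuple of w.1.2 :: w.2]].
  have mk : measurable_fun setT k.
    apply: measurable_cons; first exact: measurableT_comp.
    by apply: measurable_cons; first exact: measurableT_comp.
  have := @measurable_fun_xsection _ _ _ _ _ (@lebesgue_tuple R n) (k @^-1` A).
  rewrite (_ : _ \o _ = F) => [|/=]; last first.
    by apply/funext => z /=; rewrite xsectionE.
  by apply; rewrite -[X in measurable X]setTI; exact: mk.
have F0 z : (0 <= F z)%E by [].
have IF B : (lebesgue_tuple B = \int[mu]_x \int[mu]_y lebesgue_tuple
  [set u : n.-tuple R | B [tuple of x :: [tuple of y :: u]]])%E.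
  by rewrite lebesgue_tupleS; apply: eq_integral => x _; rewrite lebesgue_tupleS.
rewrite [LHS]IF [RHS]IF; transitivity (\int[mu]_x \int[mu]_y F (g (x, y)))%E.
  apply: eq_integral => x _; apply: eq_integral => y _.
  rewrite /F; congr lebesgue_tuple; apply/funext => u /=; congr (A _).
  rewrite !theadE.
  have -> : thead [tuple of behead [tuple of x :: [tuple of y :: u]]] = y.
    by rewrite /thead (tnth_nth 0).
  by apply/val_inj.
exact: Hg mF F0.
Qed.

Lemma dot_cons n x y (u v : n.-tuple R) :
  dot [tuple of x :: u] [tuple of y :: v] = x * y + dot u v.
Proof.
by rewrite /dot big_ord_recl !tnth0; congr +%R; apply: eq_bigr => i _; rewrite !tnthS.
Qed.

Lemma dot_ge0 n (u : n.-tuple R) : 0 <= dot u u.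
Proof. by apply: sumr_ge0 => i _; rewrite -expr2 sqr_ge0. Qed.

Lemma enorm_cons n a (v : n.-tuple R) :
  enorm [tuple of a :: v] = Num.sqrt (a ^+ 2 + dot v v).
Proof. by rewrite /enorm dot_cons. Qed.

(** Once g has aligned v with an axis, the vector (a, v) acts like (a, c, 0, ..., 0), and a rotation
    of the first two coordinates aligns it with the first axis. *)
Lemma rotation_to_axis_cons n a c (v : n.+1.-tuple R) g : tuple_preserving g ->
  (forall x, dot v (g x) = c * thead x) -> c ^+ 2 = dot v v ->
  (forall x, dot (g x) (g x) = dot x x) ->
  exists2 h, tuple_preserving h & forall x,
    dot [tuple of a :: v] (h x) = enorm [tuple of a :: v] * thead x /\
    dot (h x) (h x) = dot x x.
Proof.
move=> pg vg cE gg; have [k pk kE] := plane_preserving_rotation a c.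
have := tuple_preserving_comp (tuple_preserving_cons pg) (tuple_preserving_plane n pk).
set h := _ \o _ => ph; exists h => // x.
case/tupleP: x => x y; case/tupleP: y => y u.
have -> : h [tuple of x :: [tuple of y :: u]] =
    [tuple of (k (x, y)).1 :: g [tuple of (k (x, y)).2 :: u]].
  apply/val_inj; rewrite /h /= !theadE.
  have -> : thead [tuple of behead [tuple of x :: [tuple of y :: u]]] = y.
    by rewrite /thead (tnth_nth 0).
  congr (_ :: val (g _)); exact/val_inj.
have [k1 k2] := kE (x, y).
rewrite !dot_cons vg gg dot_cons enorm_cons -cE theadE k1 -!expr2; split => //.
by rewrite addrA k2 -addrA.
Qed.

(** In dimension one g is the identity and c is the single coordinate, possibly negative; hence only
    its square is recorded. *)
Lemma rotation_to_axis_up_to_sign n (v : n.+1.-tuple R) : exists g c,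
  [/\ tuple_preserving g, forall x, dot v (g x) = c * thead x, c ^+ 2 = dot v v
    & forall x, dot (g x) (g x) = dot x x].
Proof.
elim: n v => [|n IH] v; case/tupleP: v => a v.
  exists id, a; split=> //.
  - move=> x; case/tupleP: x => x u.
    by rewrite dot_cons theadE /dot big_ord0 addr0.
  - by rewrite dot_cons /dot big_ord0 addr0.
have [g [c [pg vg cE gg]]] := IH v.
have [h ph hE] := rotation_to_axis_cons a pg vg cE gg.
exists h, (enorm [tuple of a :: v]); split => // [x||x].
- by have [] := hE x.
- by rewrite sqr_sqrtr// dot_ge0.
- by have [] := hE x.
Qed.

(** From dimension two on, the last plane rotation replaces c by a square root, which settles the
    sign. *)
Lemma rotation_to_axis n (v : n.+2.-tuple R) : exists2 g,
  tuple_preserving g & forall x,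
    dot v (g x) = enorm v * thead x /\ dot (g x) (g x) = dot x x.
Proof.
case/tupleP: v => a v.
have [g [c [pg vg cE gg]]] := rotation_to_axis_up_to_sign v.
exact: rotation_to_axis_cons pg vg cE gg.
Qed.

End rotation.

(** * Volumes of balls, and reduction of a cone to the first axis *)

Section volume.
Context {R : realType}.
Implicit Types (n : nat) (r t : R).
Local Notation mu := (@lebesgue_measure R).

(** The product of the slicing ratios is kept in place of the Gamma function formula, since only the
    ratio of consecutive volumes matters. *)
Definition unit_ball_volume n : R := \prod_(i < n) cos_int i.+1.

Lemma unit_ball_volume_gt0 n : 0 < unit_ball_volume n.
Proof. by apply: prodr_gt0 => i _; exact: cos_int_gt0. Qed.

Lemma unit_ball_volumeS n :
  unit_ball_volume n.+1 = unit_ball_volume n * cos_int n.+1.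
Proof. by rewrite /unit_ball_volume big_ord_recr. Qed.

Lemma measurable_dot n (v : n.-tuple R) : measurable_fun setT (fun x => dot v x).
Proof.
apply: measurable_sum => i; apply: measurable_funM => //.
exact: measurable_tnth.
Qed.

Lemma measurable_dot_self n : measurable_fun setT (fun x : n.-tuple R => dot x x).
Proof.
by apply: measurable_sum => i; apply: measurable_funM; exact: measurable_tnth.
Qed.

Lemma measurable_enorm n : measurable_fun setT (@enorm R n).
Proof.
apply: measurableT_comp; last exact: measurable_dot_self.
apply: continuous_measurable_fun; exact: sqrt_continuous.
Qed.

Lemma measurable_ball n r : measurable [set x : n.-tuple R | dot x x <= r].
Proof.
rewrite -[X in measurable X]setTI.
exact: (measurable_dot_self measurableT (@measurable_itv _ `]-oo, r])).
Qed.

(** The slice at height x is a ball of radius sqrt(r^2 - x^2) in one dimension less, and is empty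
    when |x| > r. The case r = 0 shows later that the origin is negligible. *)
Lemma lebesgue_tuple_ball n r : 0 <= r ->
  lebesgue_tuple [set x : n.-tuple R | dot x x <= r ^+ 2] =
  (unit_ball_volume n * r ^+ n)%:E.
Proof.
elim: n r => [|n IH] r r0.
  rewrite /unit_ball_volume big_ord0 expr0 mulr1 /= diracE mem_set//=.
  by rewrite /dot big_ord0 sqr_ge0.
have sqrE x : (`|x| <= r) = (x ^+ 2 <= r ^+ 2).
  by rewrite -[x ^+ 2]real_normK ?num_real// ler_sqr ?nnegrE.
rewrite lebesgue_tupleS; transitivity (\int[mu]_(x in `[(- r)%R, r])
    ((unit_ball_volume n)%:E * (Num.sqrt (r ^+ 2 - x ^+ 2) ^+ n)%:E))%E.
  rewrite [RHS]integral_mkcond; apply: eq_integral => x _.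
  rewrite patchE; case: ifPn => [|/negP xr].
    rewrite inE/= in_itv/= -ler_norml => xr.
    have rx : 0 <= r ^+ 2 - x ^+ 2 by rewrite subr_ge0 -sqrE.
    rewrite -EFinM -IH ?sqrtr_ge0// sqr_sqrtr//; congr lebesgue_tuple.
    by apply/funext => y /=; rewrite dot_cons lerBrDl expr2.
  rewrite (_ : [set _ | _] = set0) ?measure0//.
  rewrite -subset0 => y /=; rewrite dot_cons => yr; apply: xr.
  rewrite inE/= in_itv/= -ler_norml sqrE.
  by apply: le_trans yr; rewrite expr2 lerDl dot_ge0.
rewrite ge0_integralZl//=.
- by rewrite integral_sqrt_sqrB// -EFinM unit_ball_volumeS -mulrA [r ^+ _ * _]mulrC.
- apply/measurable_EFinP/measurable_funTS.
  exact: (continuous_measurable_fun (@continuous_sqrt_sqrB _ r n)).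
- by rewrite lee_fin ltW// unit_ball_volume_gt0.
Qed.

(** The origin is left out because a solid cone uses only positive radii; this set is the solid cone
    over the whole sphere. *)
Definition punctured_ball n : set (n.-tuple R) :=
  [set x | 0 < dot x x <= 1].

Lemma measurable_punctured_ball n : measurable (@punctured_ball n).
Proof.
rewrite -[X in measurable X]setTI.
have := measurable_dot_self measurableT (@measurable_itv _ `]0, 1]).
by move=> /(_ n); congr measurable; apply/seteqP; split => x /=; rewrite in_itv.
Qed.

Lemma lebesgue_punctured_ball n :
  lebesgue_tuple (@punctured_ball n.+1) = (unit_ball_volume n.+1)%:E.
Proof.
have E : [set x : n.+1.-tuple R | dot x x <= 1 ^+ 2] =
    @punctured_ball n.+1 `|` [set x | dot x x <= 0 ^+ 2].
  apply/seteqP; split => x /=; rewrite expr1n expr0n/=.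
    by move=> x1; case: (ltP 0 (dot x x)) => x0; [left; apply/andP|right].
  by case=> [/andP[]//|/le_trans]; apply.
have := @lebesgue_tuple_ball n.+1 1 ler01; rewrite E measureU; last 3 first.
- exact: measurable_punctured_ball.
- exact: measurable_ball.
- rewrite -subset0 => x [/= /andP[x0 _]]; rewrite expr0n/= => /(lt_le_trans x0).
  by rewrite ltxx.
rewrite [X in (_ + X)%E = _](@lebesgue_tuple_ball n.+1 0)//.
by rewrite expr0n/= mulr0 adde0 expr1n mulr1.
Qed.

(** The solid cone over the cap where the inner product with v exceeds t; multiplying by the norm
    avoids normalizing x. *)
Definition cone_cap n (v : n.-tuple R) t : set (n.-tuple R) :=
  @punctured_ball n `&` [set x | t * enorm x < dot v x].

Lemma measurable_cone_cap n (v : n.-tuple R) t : measurable (cone_cap v t).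
Proof.
apply: measurableI; first exact: measurable_punctured_ball.
rewrite -[X in measurable X]setTI.
have mf : measurable_fun setT (fun x => dot v x - t * enorm x).
  apply: measurable_funB; first exact: measurable_dot.
  by apply: measurable_funM => //; exact: measurable_enorm.
have := mf measurableT _ (@measurable_itv _ `]0, +oo[).
by congr measurable; apply/seteqP; split => x /=; rewrite in_itv/= andbT subr_gt0.
Qed.

Definition axis_cap n t : set (n.+1.-tuple R) :=
  @punctured_ball n.+1 `&` [set x | t * enorm x < thead x].

Lemma lebesgue_cone_cap n (v : n.+2.-tuple R) t : enorm v = 1 ->
  lebesgue_tuple (cone_cap v t) = lebesgue_tuple (@axis_cap n.+1 t).
Proof.
move=> v1; have [g [_ Hg] gE] := rotation_to_axis v.
rewrite -Hg; last exact: measurable_cone_cap.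
congr lebesgue_tuple; apply/funext => x; rewrite /cone_cap /axis_cap.
rewrite /punctured_ball /preimage /= /enorm.
by have [-> ->] := gE x; rewrite v1 mul1r.
Qed.

End volume.

(** * Upper bound for the volume of the cone over a cap *)

Section cap_volume.
Context {R : realType}.
Implicit Types (n : nat) (t : R).
Local Notation mu := (@lebesgue_measure R).

Lemma measurable_cons_section n (A : set (n.+1.-tuple R)) : measurable A ->
  measurable_fun setT
    (fun x => lebesgue_tuple [set y : n.-tuple R | A [tuple of x :: y]]).
Proof.
move=> mA; pose k (w : R * n.-tuple R) := [tuple of w.1 :: w.2].
have mkA : measurable (k @^-1` A).
  by rewrite -[X in measurable X]setTI; exact: measurable_cons_tuple.
have := measurable_fun_xsection (@lebesgue_tuple R n) mkA.
congr measurable_fun.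
by apply/funext => x /=; rewrite xsectionE.
Qed.

Lemma measurable_cons_set n (A : set (n.+1.-tuple R)) x : measurable A ->
  measurable [set y : n.-tuple R | A [tuple of x :: y]].
Proof.
by move=> mA; rewrite -[X in measurable X]setTI; apply: measurable_cons.
Qed.

Lemma measurable_axis_cap n t : measurable (@axis_cap R n t).
Proof.
apply: measurableI; first exact: measurable_punctured_ball.
rewrite -[X in measurable X]setTI.
have mf : measurable_fun setT (fun x : n.+1.-tuple R => thead x - t * enorm x).
  apply: measurable_funB; first exact: measurable_tnth.
  by apply: measurable_funM => //; exact: measurable_enorm.
have := mf measurableT _ (@measurable_itv _ `]0, +oo[).
by congr measurable; apply/seteqP; split => x /=; rewrite in_itv/= andbT subr_gt0.
Qed.

(** A coordinate never exceeds the norm, so the cone is empty. Thresholds of this size occur when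
    delta is large. *)
Lemma lebesgue_axis_cap_ge1 n t : 1 <= t ->
  lebesgue_tuple (@axis_cap R n t) = 0%E.
Proof.
move=> t1; rewrite (_ : axis_cap t = set0) ?measure0//.
rewrite -subset0 => x; case/tupleP: x => x y [/= /andP[q0 _]].
rewrite theadE; apply/negP; rewrite -leNgt (le_trans (ler_norm x))//.
apply: (@le_trans _ _ (enorm [tuple of x :: y])); last first.
  by rewrite ler_peMl// sqrtr_ge0.
by rewrite enorm_cons -sqrtr_sqr ler_wsqrtr// lerDl dot_ge0.
Qed.

Lemma integral_pow n (a t : R) : 0 < t ->
  (\int[mu]_(x in `[0%R, t]) ((a * x) ^+ n)%:E =
   (a ^+ n * t ^+ n.+1 / n.+1%:R)%:E)%E.
Proof.
move=> t0; pose F : R -> R := (a ^+ n / n.+1%:R) \*: (@id R) ^+ n.+1.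
have dF (x : R) : is_derive x 1 F ((a * x) ^+ n).
  apply: is_derive_eq.
  rewrite /GRing.scale/= mulr1 mulrA divfK ?pnatr_eq0// exprMn.
  by congr (_ * _).
rewrite (integral_is_derive t0 _ dF).
  rewrite -EFinB; congr EFin; rewrite /F/= /GRing.scale/= !exprfctE.
  by rewrite expr0n/= mulr0 subr0 mulrAC.
move=> x; apply: (@continuous_comp _ _ _ (fun x : R => a * x) (fun y : R => y ^+ n)).
  by apply: cvgMr; exact: cvg_id.
exact: exprn_continuous.
Qed.

(** An antiderivative is -(1 - x^2)^((n+2)/2) / (n+2), which vanishes at x = 1. *)
Lemma integral_mulr_sqrt n t : 0 < t < 1 ->
  (\int[mu]_(x in `[t, 1%R]) (x * Num.sqrt (1 - x ^+ 2) ^+ n)%:E =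
   (Num.sqrt (1 - t ^+ 2) ^+ n.+2 / n.+2%:R)%:E)%E.
Proof.
move=> /andP[t0 t1].
pose F (x : R) : R := - n.+2%:R^-1 * Num.sqrt (1 ^+ 2 - x ^+ 2) ^+ n.+2.
pose f (x : R) : R := x * Num.sqrt (1 - x ^+ 2) ^+ n.
have cf : continuous f.
  move=> x; apply: cvgM; first exact: cvg_id.
  by have := @continuous_sqrt_sqrB R 1 n x; rewrite expr1n.
have cF : continuous F.
  by move=> x; apply: cvgMr; exact: (@continuous_sqrt_sqrB R 1 n.+2 x).
(* The chain rule through the square root requires 1 - x^2 > 0, so the derivative is taken in the
   open interval only; continuity handles the endpoints. *)
have dF (x : R) : x \in `]t, 1[ -> is_derive x 1 F (f x).
  rewrite in_itv/= => /andP[tx x1].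
  have q0 : 0 < 1 ^+ 2 - x ^+ 2.
    by rewrite expr1n subr_gt0 expr_lt1// ltW// (lt_trans t0).
  pose q : R -> R := cst (1 ^+ 2) - (@id R) ^+ 2.
  have dq : is_derive x 1 q (- (2 * x)).
    by apply: is_derive_eq; rewrite /GRing.scale/= expr1 mulr1 sub0r mulr_natl.
  have qx : 0 < q x by [].
  have d3 := is_deriveX n.+2 (is_derive1_comp (is_derive1_sqrt qx) dq).
  have -> : F = - n.+2%:R^-1 \*: ((@Num.sqrt R \o q) ^+ n.+2).
    by apply/funext => y; rewrite /F/= exprfctE.
  have d4 := is_deriveZ (- n.+2%:R^-1) d3.
  apply: (is_derive_eq d4).
  have -> : f x = x * Num.sqrt (q x) ^+ n by rewrite /f /q /= expr1n.
  rewrite /GRing.scale/= exprS.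
  have sN0 : Num.sqrt (q x) != 0 by rewrite gt_eqF// sqrtr_gt0.
  by field; rewrite sN0 -(natrD _ 2) pnatr_eq0.
rewrite [LHS](@continuous_FTC2 _ f F)//.
- rewrite /F !expr1n subrr sqrtr0 expr0n/= mulr0 -EFinB sub0r mulNr opprK.
  by rewrite mulrC.
- exact: continuous_subspaceT.
- split => [x /dF[]//||]; first exact/cvg_at_right_filter/cF.
  exact/cvg_at_left_filter/cF.
- by move=> x /dF dFx; rewrite derive1E; apply: derive_val.
Qed.

(** Up to height t the cone inequality confines the slice to a ball of radius x sqrt(1 - t^2) / t;
    between t and 1 the unit ball confines it to radius sqrt(1 - x^2); other slices are empty. The
    overlap at x = t is harmless for an upper bound. *)
Lemma axis_cap_section_le n t x : 0 < t < 1 ->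
  (lebesgue_tuple [set y : n.-tuple R | axis_cap t [tuple of x :: y]] <=
   ((fun x => (unit_ball_volume n * (Num.sqrt (1 - t ^+ 2) / t * x) ^+ n)%:E)
      \_ `[0%R, t]) x +
   ((fun x => (unit_ball_volume n / t * (x * Num.sqrt (1 - x ^+ 2) ^+ n))%:E)
      \_ `[t, 1%R]) x)%E.
Proof.
move=> /andP[t0 t1]; set s := Num.sqrt (1 - t ^+ 2).
have V0 : 0 < unit_ball_volume n :> R by exact: unit_ball_volume_gt0.
have s0 : 0 <= s by exact: sqrtr_ge0.
set f := _ \_ _; set g := _ \_ _.
have f0 y : (0 <= f y)%E.
  apply: erestrict_ge0 => z /=; rewrite in_itv/= => /andP[z0 _].
  by rewrite lee_fin (mulr_ge0 (ltW V0))// exprn_ge0// mulr_ge0// divr_ge0// ltW.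
have g0 y : (0 <= g y)%E.
  apply: erestrict_ge0 => z /=; rewrite in_itv/= => /andP[tz _].
  rewrite lee_fin mulr_ge0//; first by rewrite divr_ge0// ltW.
  by rewrite mulr_ge0 ?exprn_ge0 ?sqrtr_ge0// (le_trans (ltW t0)).
have t21 : 0 <= 1 - t ^+ 2 by rewrite subr_ge0 expr_le1// ltW.
have mS := measurable_cons_set x (@measurable_axis_cap n t).
have [x0|x0] := leP x 0.
  rewrite (_ : [set _ | _] = set0) ?measure0 ?adde_ge0//.
  rewrite -subset0 => y [_ /=]; rewrite theadE => /lt_le_trans/(_ x0).
  by rewrite ltNge mulr_ge0 ?sqrtr_ge0// ltW.
have [xt|xt] := leP x t.
  apply: (@le_trans _ _ (f x)); last by rewrite leeDl.
  rewrite /f patchE mem_set/=; last by rewrite in_itv/= xt ltW.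
  rewrite -lebesgue_tuple_ball; last by rewrite mulr_ge0 ?divr_ge0// ltW.
  apply: le_measure; rewrite ?inE//; first exact: measurable_ball.
  move=> y [_ /=]; rewrite theadE enorm_cons => xy.
  rewrite !exprMn exprVn sqr_sqrtr// mulrAC ler_pdivlMr ?exprn_gt0//.
  have : (t * Num.sqrt (x ^+ 2 + dot y y)) ^+ 2 < x ^+ 2.
    by rewrite ltr_sqr ?nnegrE ?mulr_ge0 ?sqrtr_ge0 ?ltW.
  rewrite exprMn sqr_sqrtr ?addr_ge0 ?sqr_ge0 ?dot_ge0// mulrDr => xyt.
  lra.
have [x1|x1] := leP x 1.
  apply: (@le_trans _ _ (g x)); last by rewrite leeDr.
  rewrite /g patchE mem_set/=; last by rewrite in_itv/= x1 ltW.
  (* The true slice bound is then enlarged by the factor x / t, which is at least 1 here and makes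
     the integrand an exact derivative. *)
  apply: (@le_trans _ _ (unit_ball_volume n * Num.sqrt (1 - x ^+ 2) ^+ n)%:E).
    rewrite -lebesgue_tuple_ball ?sqrtr_ge0//.
    apply: le_measure; rewrite ?inE//; first exact: measurable_ball.
    move=> y [/= /andP[_]]; rewrite dot_cons -expr2 => xy _.
    rewrite sqr_sqrtr; first by rewrite lerBrDl.
    by rewrite subr_ge0 expr_le1// ltW.
  rewrite lee_fin -mulrA ler_pM2l ?unit_ball_volume_gt0// mulrA.
  by rewrite ler_peMl ?exprn_ge0 ?sqrtr_ge0// mulrC ler_pdivlMr// mul1r ltW.
rewrite (_ : [set _ | _] = set0) ?measure0 ?adde_ge0//.
rewrite -subset0 => y [/= /andP[_]]; rewrite dot_cons -expr2 => + _.
apply/negP; rewrite -ltNge (lt_le_trans (_ : 1 < x ^+ 2))//.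
  by rewrite expr_gt1// ltW.
by rewrite lerDl dot_ge0.
Qed.

Lemma lebesgue_axis_cap n t : 0 < t < 1 ->
  (lebesgue_tuple (@axis_cap R n t) <=
   (unit_ball_volume n * Num.sqrt (1 - t ^+ 2) ^+ n / (t * n.+1%:R))%:E)%E.
Proof.
move=> t01; have /andP[t0 t1] := t01.
have V0 : 0 < unit_ball_volume n :> R by exact: unit_ball_volume_gt0.
set s := Num.sqrt (1 - t ^+ 2); have s0 : 0 <= s by exact: sqrtr_ge0.
have s2 : s ^+ 2 = 1 - t ^+ 2 by rewrite sqr_sqrtr// subr_ge0 expr_le1// ltW.
pose f x : \bar R := (unit_ball_volume n * (s / t * x) ^+ n)%:E.
pose g x : \bar R := (unit_ball_volume n / t * (x * Num.sqrt (1 - x ^+ 2) ^+ n))%:E.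
have mX : measurable_fun [set: R] (fun x : R => (s / t * x) ^+ n).
  by apply: measurable_funX; exact: measurable_funM.
have mS : measurable_fun [set: R] (fun x : R => x * Num.sqrt (1 - x ^+ 2) ^+ n).
  apply: measurable_funM => //.
  have := continuous_measurable_fun (@continuous_sqrt_sqrB R 1 n).
  by rewrite expr1n.
have mf : measurable_fun [set: R] f.
  by apply/measurable_EFinP; exact: measurable_funM.
have mg : measurable_fun [set: R] g.
  by apply/measurable_EFinP; exact: measurable_funM.
have f0 x : `[0, t]%classic x -> (0 <= f x)%E.
  rewrite /= in_itv/= => /andP[x0 _].
  by rewrite lee_fin (mulr_ge0 (ltW V0))// exprn_ge0// mulr_ge0// divr_ge0// ltW.
have g0 x : `[t, 1]%classic x -> (0 <= g x)%E.
  rewrite /= in_itv/= => /andP[tx _].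
  rewrite lee_fin mulr_ge0//; first by rewrite divr_ge0// ltW.
  by rewrite mulr_ge0 ?exprn_ge0 ?sqrtr_ge0// (le_trans (ltW t0)).
rewrite lebesgue_tupleS.
apply: (@le_trans _ _ (\int[mu]_x ((f \_ `[0%R, t]) x + (g \_ `[t, 1%R]) x))%E).
  apply: ge0_le_integral => //.
  - by have := measurable_cons_section (@measurable_axis_cap n t).
  - apply: emeasurable_funD; apply/(measurable_restrictT _ _).1 => //;
    exact: measurable_funTS.
  - by move=> x _; exact: axis_cap_section_le.
rewrite ge0_integralD//; last 4 first.
- by move=> x _; exact: erestrict_ge0.
- by apply/(measurable_restrictT _ _).1 => //; exact: measurable_funTS.
- by move=> x _; exact: erestrict_ge0.
- by apply/(measurable_restrictT _ _).1 => //; exact: measurable_funTS.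
rewrite -!integral_mkcond.
have -> : (\int[mu]_(x in `[0%R, t]) f x =
    (unit_ball_volume n * ((s / t) ^+ n * t ^+ n.+1 / n.+1%:R))%:E)%E.
  rewrite /f; under eq_integral do rewrite EFinM.
  rewrite ge0_integralZl//=; first by rewrite integral_pow// -EFinM.
  - by apply/measurable_EFinP/measurable_funTS.
  - move=> x; rewrite in_itv/= => /andP[x0 _].
    by rewrite lee_fin exprn_ge0// mulr_ge0// divr_ge0// ltW.
  - by rewrite lee_fin ltW.
have -> : (\int[mu]_(x in `[t, 1%R]) g x =
    (unit_ball_volume n / t * (s ^+ n.+2 / n.+2%:R))%:E)%E.
  rewrite /g; under eq_integral do rewrite EFinM.
  rewrite ge0_integralZl//=; first by rewrite integral_mulr_sqrt// -EFinM.
  - by apply/measurable_EFinP/measurable_funTS.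
  - move=> x; rewrite in_itv/= => /andP[tx _].
    by rewrite lee_fin mulr_ge0 ?exprn_ge0 ?sqrtr_ge0// (le_trans (ltW t0)).
  - by rewrite lee_fin divr_ge0// ltW.
rewrite -EFinD lee_fin.
rewrite -(mulrA _ t^-1) -(mulrA _ (s ^+ n)) -mulrDr ler_pM2l// expr_div_n.
have tN0 : t != 0 by rewrite gt_eqF.
have n1 : 1 + n%:R != 0 :> R by rewrite nat1r pnatr_eq0.
have n2 : 2 + n%:R != 0 :> R by rewrite -(natrD _ 2) pnatr_eq0.
have -> : s ^+ n / t ^+ n * t ^+ n.+1 / n.+1%:R = s ^+ n * (t / n.+1%:R).
  by rewrite exprS; field; rewrite n1 expf_neq0.
have -> : t^-1 * (s ^+ n.+2 / n.+2%:R) = s ^+ n * (s ^+ 2 / t / n.+2%:R).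
  by rewrite !exprS; field; rewrite n2.
rewrite -mulrDr ler_wpM2l ?exprn_ge0//.
(* Weakening n + 2 to n + 1 in the second term lets the sum collapse, because t + (1 - t^2) / t = 1
   / t. *)
apply: (@le_trans _ _ (t / n.+1%:R + s ^+ 2 / t / n.+1%:R)).
  rewrite lerD2l ler_wpM2l ?divr_ge0 ?sqr_ge0 ?(ltW t0)//.
  by rewrite lef_pV2 ?posrE// ler_nat.
rewrite le_eqVlt; apply/orP; left; apply/eqP.
by rewrite s2; field; rewrite n1.
Qed.

End cap_volume.

(** * From cone volumes to probabilities of caps and the union bound *)

Section sphere_probability.
Context {R : realType}.
Implicit Types (n : nat) (r t : R).

Lemma dotZr n (v u : n.-tuple R) r :
  dot v [tuple r * tnth u i | i < n] = r * dot v u.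
Proof.
by rewrite /dot mulr_sumr; apply: eq_bigr => i _; rewrite tnth_mktuple mulrCA.
Qed.

Lemma dotNl n (v u : n.-tuple R) : dot [tuple - tnth v i | i < n] u = - dot v u.
Proof.
by rewrite /dot -sumrN; apply: eq_bigr => i _; rewrite tnth_mktuple mulNr.
Qed.

Lemma dotC n (v u : n.-tuple R) : dot v u = dot u v.
Proof. by apply: eq_bigr => i _; rewrite mulrC. Qed.

Lemma enormN n (v : n.-tuple R) : enorm [tuple - tnth v i | i < n] = enorm v.
Proof. by rewrite /enorm dotNl dotC dotNl opprK. Qed.

Lemma enorm_eq1 n (u : n.-tuple R) : (enorm u = 1) <-> (dot u u = 1).
Proof.
rewrite /enorm; split => [u1|->]; last exact: sqrtr1.
by rewrite -[LHS]sqr_sqrtr ?dot_ge0// u1 expr1n.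
Qed.

Lemma dot_scale n (u : n.-tuple R) r :
  let x := [tuple r * tnth u i | i < n] in dot x x = r ^+ 2 * dot u u.
Proof. by move=> x; rewrite dotZr dotC dotZr mulrA expr2. Qed.

(** Polar coordinates: in x = r u with u of norm one, the radius must be the norm of x and u its
    normalization. *)
Lemma solid_cone_sphere n (A : set (n.-tuple R)) x :
  solid_cone (A `&` @sphere R n) x <->
  punctured_ball x /\ A [tuple (enorm x)^-1 * tnth x i | i < n].
Proof.
split.
  move=> [r [u [/andP[r0 r1] [Au /enorm_eq1 u1]] ->]].
  have xx := dot_scale u r; rewrite u1 mulr1 in xx.
  split; first by rewrite /punctured_ball /= xx exprn_gt0//= expr_le1// ltW.
  rewrite (_ : [tuple _ | _ < _] = u)//; apply: eq_from_tnth => i.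
  by rewrite !tnth_mktuple /enorm xx sqrtr_sqr gtr0_norm// mulKf// gt_eqF.
move=> [/andP[x0 x1] Ax].
have e0 : 0 < enorm x by rewrite sqrtr_gt0.
exists (enorm x), [tuple (enorm x)^-1 * tnth x i | i < n]; last first.
  by apply: eq_from_tnth => i; rewrite !tnth_mktuple mulVKf// gt_eqF.
split; first by rewrite e0 -sqrtr1 ler_wsqrtr.
split => //; apply/enorm_eq1; rewrite dot_scale exprVn sqr_sqrtr ?(ltW x0)//.
by rewrite mulVf// gt_eqF.
Qed.

Lemma solid_cone_cap n (v : n.-tuple R) t :
  solid_cone ([set u | t < dot v u] `&` @sphere R n) = cone_cap v t.
Proof.
apply/funext => x; apply/propext; rewrite solid_cone_sphere /cone_cap /=.
split => -[B]; have /andP[x0 _] := B.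
all: have e0 : 0 < enorm x by rewrite sqrtr_gt0.
all: by rewrite dotZr ltr_pdivlMl// mulrC.
Qed.

Lemma surface_measure_sphere n :
  surface_measure (@sphere R n.+1) = (n.+1%:R * unit_ball_volume n.+1)%:E.
Proof.
rewrite /surface_measure setIid -[X in solid_cone X]setTI.
rewrite (_ : solid_cone _ = @punctured_ball R n.+1).
  by rewrite lebesgue_punctured_ball EFinM.
by apply/funext => x; apply/propext; rewrite solid_cone_sphere; split => [[]|].
Qed.

(** Here n is the dimension of the sphere, one less than that of the space. The denominator comes
    from bounding (n+1) C_(n+1) below by sqrt(2 pi n). *)
Definition cap_bound n t : R :=
  Num.sqrt (1 - t ^+ 2) ^+ n / (Num.sqrt (2 * pi * n%:R) * t).

Lemma cap_bound_ge0 n t : 0 < t -> 0 <= cap_bound n t.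
Proof.
by move=> t0; rewrite divr_ge0 ?exprn_ge0 ?mulr_ge0 ?sqrtr_ge0// ltW.
Qed.

Lemma normalized_surface_measure_cap n (v : n.+2.-tuple R) t :
  enorm v = 1 -> 0 < t ->
  (normalized_surface_measure [set u | (t < dot v u)%R] <= (cap_bound n.+1 t)%:E)%E.
Proof.
move=> v1 t0; rewrite /normalized_surface_measure surface_measure_sphere.
rewrite /surface_measure solid_cone_cap lebesgue_cone_cap//.
have [t1|t1] := leP 1 t.
  by rewrite lebesgue_axis_cap_ge1// mule0 mul0e lee_fin cap_bound_ge0.
have V0 := @unit_ball_volume_gt0 R n.+1; have C0 := @cos_int_gt0 R n.+2.
have N0 : 0 < n.+2%:R :> R by [].
have t01 : 0 < t < 1 by rewrite t0.
have c0 : (0 <= lebesgue_tuple (@axis_cap R n.+1 t))%E by [].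
have := lebesgue_axis_cap n.+1 t01; move: c0.
(* The cone volume lies between 0 and a real number, so it is finite and the quotient can be treated
   in the reals. *)
case: (lebesgue_tuple _) => [c||]; rewrite ?lee_fin ?leye_eq// => c0 cK.
rewrite inver gt_eqF ?mulr_gt0// ?unit_ball_volume_gt0// -!EFinM lee_fin.
rewrite unit_ball_volumeS ler_pdivrMr ?mulr_gt0//.
have sq0 : 0 < Num.sqrt (2 * pi * n.+1%:R) :> R.
  by rewrite sqrtr_gt0 !mulr_gt0// pi_gt0.
have sqC : Num.sqrt (2 * pi * n.+1%:R) <= n.+2%:R * cos_int n.+2 :> R.
  rewrite -[leRHS]ger0_norm ?mulr_ge0 ?cos_int_ge0// -sqrtr_sqr.
  by rewrite ler_wsqrtr// cos_int_lb.
set s := Num.sqrt (1 - t ^+ 2) ^+ n.+1; have s0 : 0 <= s.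
  by rewrite exprn_ge0// sqrtr_ge0.
have tN0 : t != 0 by rewrite gt_eqF.
have n2 : 2 + n%:R != 0 :> R by rewrite -(natrD _ 2) pnatr_eq0.
apply: (@le_trans _ _ (n.+2%:R * (unit_ball_volume n.+1 * s / (t * n.+2%:R)))).
  by rewrite ler_pM2l.
have -> : n.+2%:R * (unit_ball_volume n.+1 * s / (t * n.+2%:R)) =
    unit_ball_volume n.+1 * s / t.
  by field; rewrite ?n2 ?tN0.
rewrite /cap_bound -/s; set q := Num.sqrt (2 * _ * _) in sq0 sqC *.
have -> : s / (q * t) * (n.+2%:R * (unit_ball_volume n.+1 * cos_int n.+2)) =
    unit_ball_volume n.+1 * s / t * (n.+2%:R * cos_int n.+2 / q).
  by field; rewrite ?n2 tN0 gt_eqF.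
rewrite ler_peMr ?ler_pdivlMr ?mul1r//.
by rewrite mul0r mulr_ge0// ltW.
Qed.

Lemma probability_cap d (T : measurableType d) (P : probability T R) n
    (U : {RV P >-> n.+2.-tuple R}) (v : n.+2.-tuple R) t :
  uniform_on_sphere U -> enorm v = 1 -> 0 < t ->
  (P [set w | (t < dot v (U w))%R] <= (cap_bound n.+1 t)%:E)%E.
Proof.
move=> Uunif v1 t0.
have mA : measurable [set u : n.+2.-tuple R | t < dot v u].
  rewrite -[X in measurable X]setTI.
  have := measurable_dot v measurableT (@measurable_itv _ `]t, +oo[).
  by congr measurable; apply/seteqP; split => x /=; rewrite in_itv/= andbT.
apply: le_trans (normalized_surface_measure_cap v1 t0).
by rewrite -Uunif.
Qed.

Lemma measure_bigsetU_le d (T : measurableType d) (m : {measure set T -> \bar R})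
    (I : Type) (s : seq I) (F : I -> set T) (c : \bar R) :
  (forall i, measurable (F i)) -> (forall i, m (F i) <= c)%E ->
  (m (\big[setU/set0]_(i <- s) F i) <= \sum_(i <- s) c)%E.
Proof.
move=> mF mc; elim: s => [|i s IH]; first by rewrite !big_nil measure0.
rewrite !big_cons (le_trans (measureU2 _ _ _))//.
  by apply: bigsetU_measurable.
exact: leeD (mc i) IH.
Qed.

(** As t is nonnegative, the default value 0 of the maximum cannot exceed it, so an actual index
    must do so. *)
Lemma max_abs_dot_gt p n (L : 'I_p -> n.-tuple R) u t : 0 <= t ->
  t < max_abs_dot L u <-> exists j, t < `|dot (L j) u|.
Proof.
move=> t0; split => [|[j tj]].
  rewrite ltNge => /negP H; apply: contrapT => /forallNP tL; apply: H.
  by apply/bigmax_leP; split => // j _; rewrite leNgt; apply/negP.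
by apply: lt_le_trans tj _; exact: (le_bigmax _ (fun j => `|dot (L j) u|)).
Qed.

Lemma max_abs_dot_gt_set d (T : measurableType d) p n (L : 'I_p -> n.-tuple R)
    (U : T -> n.-tuple R) t : 0 <= t ->
  [set w | t < max_abs_dot L (U w)] = \big[setU/set0]_(j < p)
    ([set w | t < dot (L j) (U w)] `|`
     [set w | t < dot [tuple - tnth (L j) i | i < n] (U w)]).
Proof.
move=> t0; rewrite -bigcup_seq; apply/seteqP; split => w /=.
  move/(max_abs_dot_gt _ _ t0) => [j]; rewrite lter_normr => tj.
  by exists j => /=; rewrite ?mem_index_enum// dotNl; apply/orP.
move=> [j _ /=]; rewrite dotNl => /orP tj.
by apply/(max_abs_dot_gt _ _ t0); exists j; rewrite lter_normr.
Qed.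

Lemma measurable_dot_gt d (T : measurableType d) (P : probability T R) n
    (U : {RV P >-> n.-tuple R}) (v : n.-tuple R) t :
  measurable [set w | t < dot v (U w)].
Proof.
rewrite -[X in measurable X]setTI.
have mf : measurable_fun setT (fun w => dot v (U w)).
  by apply: (@measurableT_comp _ _ _ _ _ _ (fun x => dot v x)) => //; exact: measurable_dot.
have := mf measurableT _ (@measurable_itv _ `]t, +oo[).
by congr measurable; apply/seteqP; split => x /=; rewrite in_itv/= andbT.
Qed.

Lemma measurable_max_abs_dot_gt d (T : measurableType d) (P : probability T R) p n
    (U : {RV P >-> n.-tuple R}) (L : 'I_p -> n.-tuple R) t : 0 <= t ->
  measurable [set w | t < max_abs_dot L (U w)].
Proof.
move=> t0; rewrite max_abs_dot_gt_set//; apply: bigsetU_measurable => j _.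
by apply: measurableU; exact: measurable_dot_gt.
Qed.

Lemma probability_max_abs_dot d (T : measurableType d) (P : probability T R) p n
    (U : {RV P >-> n.+2.-tuple R}) (L : 'I_p -> n.+2.-tuple R) t :
  uniform_on_sphere U -> (forall j, enorm (L j) = 1) -> 0 < t ->
  (P [set w | (t < max_abs_dot L (U w))%R] <= (p%:R * (2 * cap_bound n.+1 t))%:E)%E.
Proof.
move=> Uunif L1 t0; rewrite (max_abs_dot_gt_set _ _ (ltW t0)).
apply: (@le_trans _ _ (\sum_(j < p) (2 * cap_bound n.+1 t)%:E)%E).
  apply: measure_bigsetU_le => j.
    by apply: measurableU; exact: measurable_dot_gt.
  rewrite (le_trans (measureU2 _ _ _))//; try exact: measurable_dot_gt.
  by rewrite mulr_natl mulr2n EFinD leeD// probability_cap// enormN.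
rewrite sumEFin sumr_const card_ord.
by rewrite lee_fin [leRHS]mulr_natl lexx.
Qed.

End sphere_probability.

(** * Estimates of the tail bound in terms of w = p^(1/(n-1)) *)

Section asymptotics.
Context {R : realType}.
Implicit Types (p n k : nat) (delta w : R).

(** The right-hand side of (i), with k standing for n - 1 and w for the root p^(1/k). *)
Definition coherence_bound k delta w : R :=
  Num.sqrt 2 * w * expR (- (1 / 2) * delta * k%:R * (w ^+ 2 - 1)) /
    Num.sqrt (pi * (1 + delta) * k%:R * (w ^+ 2 - 1)).

Lemma cap_bound_le k delta w : (0 < k)%N -> 0 <= delta -> 1 < w ->
  w ^+ k * (2 * cap_bound k (Num.sqrt ((1 + delta) * (1 - w ^- 2)))) <=
  coherence_bound k delta w.
Proof.
move=> k0 d0 w1; have w0 : 0 < w by rewrite (lt_trans _ w1).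
have wN0 : w != 0 by rewrite gt_eqF.
pose y := w ^+ 2 - 1; have y0 : 0 < y by rewrite subr_gt0 expr_gt1// ltW.
have d1 : 0 < 1 + delta by rewrite ltr_wpDr.
have wy : 1 - w ^- 2 = y / w ^+ 2 by rewrite /y; field.
set t := Num.sqrt _.
have tE : t = Num.sqrt ((1 + delta) * y) / w.
  rewrite /t wy mulrA -[in RHS](gtr0_norm w0) -sqrtr_sqr -sqrtrV ?sqr_ge0//.
  by rewrite -sqrtrM// mulr_ge0// ltW.
have t0 : 0 < t by rewrite tE divr_gt0// sqrtr_gt0 mulr_gt0.
have t2 : 1 - t ^+ 2 = (1 - delta * y) / w ^+ 2.
  rewrite tE expr_div_n sqr_sqrtr; last by rewrite mulr_ge0// ltW.
  by rewrite /y; field.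
pose E := expR (- (1 / 2) * delta * y).
have E0 : 0 < E by exact: expR_gt0.
(* This rests on 1 - delta y <= exp(-delta y). If delta y > 1 the radicand on the left is negative
   and its root is 0 by convention; monotonicity of the square root covers this case too. *)
have sE : Num.sqrt (1 - t ^+ 2) <= E / w.
  rewrite -[leRHS]ger0_norm; last by rewrite divr_ge0 ?ltW.
  rewrite -sqrtr_sqr ler_wsqrtr// t2 expr_div_n ler_pM2r ?invr_gt0 ?exprn_gt0//.
  rewrite /E -expRM_natl (le_trans _ (expR_ge1Dx _))//.
  by rewrite le_eqVlt; apply/orP; left; apply/eqP; field.
have kR : 0 < k%:R :> R by rewrite ltr0n.
have p0 := @pi_gt0 R.
set q := Num.sqrt (pi * (1 + delta) * k%:R * y).
have q0 : 0 < q by rewrite sqrtr_gt0 !mulr_gt0.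
have s20 : 0 < Num.sqrt 2 :> R by rewrite sqrtr_gt0.
have tq : Num.sqrt (2 * pi * k%:R) * t = Num.sqrt 2 * q / w.
  rewrite tE mulrA -!sqrtrM ?mulr_ge0 ?(ltW p0) ?(ltW kR)//.
  by congr (Num.sqrt _ / _); ring.
rewrite /coherence_bound /cap_bound tq -/y -/q.
apply: (@le_trans _ _ (w ^+ k * (2 * ((E / w) ^+ k / (Num.sqrt 2 * q / w))))).
  rewrite ler_pM2l ?exprn_gt0// ler_pM2l// ler_wpM2r//.
    by rewrite invr_ge0 divr_ge0 ?mulr_ge0 ?ltW.
  by rewrite lerXn2r// ?nnegrE ?sqrtr_ge0// divr_ge0 ?ltW.
have -> : expR (- (1 / 2) * delta * k%:R * y) = E ^+ k.
  by rewrite /E -expRM_natl; congr expR; ring.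
(* Writing the leading 2 as the square of sqrt(2) cancels one such factor below; w^k cancels against
   the denominator of (E / w)^k, and the remaining factor w comes from t. *)
rewrite expr_div_n -{1}(sqr_sqrtr (ler0n R 2)).
rewrite le_eqVlt; apply/orP; left; apply/eqP; field.
by rewrite !gt_eqF// ?exprn_gt0.
Qed.

(** Put a = k (w^2 - 1). From exp(x) >= 1 + x one gets a >= 2 ln(w^k), and w^2 / a = 1 / a + 1 / k;
    the factor 2 is absorbed by pi (1 + delta) >= 2. With w^k = p the bound involves only ln p and 1
    / k, which gives uniformity in n. *)
Lemma coherence_bound_le k delta w : (0 < k)%N -> 0 <= delta -> 1 < w ->
  coherence_bound k delta w <=
  Num.sqrt ((ln (w ^+ k))^-1 / 2 + k%:R^-1) * expR (- delta * ln (w ^+ k)).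
Proof.
move=> k0 d0 w1; have w0 : 0 < w by rewrite (lt_trans _ w1).
have kR : 0 < k%:R :> R by rewrite ltr0n.
pose y := w ^+ 2 - 1; have y0 : 0 < y by rewrite subr_gt0 expr_gt1// ltW.
pose a := k%:R * y; have a0 : 0 < a by rewrite mulr_gt0.
have lw : 0 < ln (w ^+ k) by rewrite ln_gt0// exprn_egt1// -lt0n.
have la : 2 * ln (w ^+ k) <= a.
  rewrite lnXn// -(mulr_natl (ln w) k) /a mulrCA ler_pM2l//.
  rewrite /y lerBrDl (le_trans (expR_ge1Dx _))//.
  by rewrite mulr_natl -lnXn// lnK// posrE exprn_gt0.
have d1 : 0 < 1 + delta by rewrite ltr_wpDr.
have p2 : 2 <= pi :> R by have := @pihalf_ge1 R; rewrite ler_pdivlMr// mul1r.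
rewrite /coherence_bound -/y.
have p0 := @pi_gt0 R.
have -> : pi * (1 + delta) * k%:R * y = pi * (1 + delta) * a by rewrite mulrA.
have -> : - (1 / 2) * delta * k%:R * y = - delta * (a / 2) by rewrite /a; field.
have -> : Num.sqrt 2 * w = Num.sqrt (2 * w ^+ 2).
  by rewrite sqrtrM// sqrtr_sqr gtr0_norm.
rewrite mulrAC -sqrtrV; last by rewrite !mulr_ge0// ltW.
rewrite -sqrtrM; last by rewrite mulr_ge0// sqr_ge0.
apply: ler_pM; rewrite ?sqrtr_ge0 ?expR_ge0//; last first.
  by rewrite ler_expR !mulNr lerN2 ler_wpM2l// ler_pdivlMr// mulrC.
apply: ler_wsqrtr.
apply: (@le_trans _ _ (w ^+ 2 / a)).
  rewrite invfM mulrA ler_pM2r ?invr_gt0//.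
  rewrite mulrAC ger_pMl ?exprn_gt0// ler_pdivrMr ?mulr_gt0// mul1r.
  by rewrite (le_trans p2)// ler_peMr ?lerDl// ltW.
have -> : w ^+ 2 / a = a^-1 + k%:R^-1.
  have -> : w ^+ 2 = 1 + y by rewrite addrC subrK.
  by rewrite /a; field; rewrite !gt_eqF.
rewrite lerD2r -invfM lef_pV2 ?posrE ?mulr_gt0//.
by rewrite mulrC.
Qed.

Lemma cvg_lnV : (ln (p%:R : R))^-1 @[p --> \oo] --> (0 : R).
Proof.
have lny : ln (p%:R : R) @[p --> \oo] --> +oo.
  apply/cvgryPge => A; near=> p.
  have Ap : expR A <= p%:R by near: p; exact: nbhs_infty_ger.
  by rewrite -[A]expRK ler_ln ?posrE ?expR_gt0// (lt_le_trans _ Ap) ?expR_gt0.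
apply/gtr0_cvgV0; last exact: lny.
near=> p; rewrite ln_gt0// ltr1n.
by near: p; exact: nbhs_infty_ge.
Unshelve. all: end_near. Qed.

Lemma cvg_predV : (n%:R - 1 : R)^-1 @[n --> \oo] --> (0 : R).
Proof.
apply/gtr0_cvgV0.
  near=> n; rewrite subr_gt0 ltr1n.
  by near: n; exact: nbhs_infty_ge.
apply/cvgryPge => A; near=> n; rewrite lerBrDr.
by near: n; exact: nbhs_infty_ger.
Unshelve. all: end_near. Qed.

End asymptotics.

(** * Real powers p^(1/k) as k-th roots *)

Section root.
Context {R : realType}.
Implicit Types p k : nat.

Lemma powR_rootX p k : (0 < k)%N -> (p%:R `^ (1 / k%:R)) ^+ k = p%:R :> R.
Proof.
move=> k0; rewrite -powR_mulrn ?powR_ge0// -powRrM divfK ?powRr1//.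
by rewrite pnatr_eq0 -lt0n.
Qed.

Lemma powR_root_gt1 p k : (2 <= p)%N -> (0 < k)%N ->
  1 < p%:R `^ (1 / k%:R) :> R.
Proof.
move=> p2 k0; rewrite ltNge; apply/negP => w1.
have := exprn_ile1 k (powR_ge0 _ _) w1.
by rewrite powR_rootX// -[1]/(1%:R) ler_nat leqNgt p2.
Qed.

Lemma powR_rootX2 p k : p%:R `^ (2 / k%:R) = (p%:R `^ (1 / k%:R)) ^+ 2 :> R.
Proof. by rewrite -powR_mulrn ?powR_ge0// -powRrM mul1r mulrC. Qed.

Lemma powR_rootXN2 p k : p%:R `^ (- 2 / k%:R) = (p%:R `^ (1 / k%:R)) ^- 2 :> R.
Proof. by rewrite mulNr powRN powR_rootX2. Qed.

End root.

(** * The tail bound, its uniformity in the dimension, and the double limit *)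

Theorem theorem1 (R : realType)
    (L : forall p n : nat, 'I_p -> n.-tuple R)
    (d : nat -> nat -> measure_display)
    (T : forall p n : nat, measurableType (d p n))
    (P : forall p n : nat, probability (T p n) R)
    (U : forall p n : nat, {RV (P p n) >-> n.-tuple R})
    (L_unit : forall p n : nat, (2 <= p)%N -> (2 <= n)%N ->
       forall j : 'I_p, enorm (L p n j) = 1)
    (U_unif : forall p n : nat, (2 <= p)%N -> (2 <= n)%N ->
       uniform_on_sphere (U p n)) :
  let M (p n : nat) (t : T p n) : R := max_abs_dot (L p n) (U p n t) in
  [/\ forall p n : nat, (2 <= p)%N -> (2 <= n)%N ->
        forall delta : R, 0 < delta ->
        (P p n [set t | (M p n t >
            Num.sqrt ((1 + delta) * (1 - p%:R `^ (- 2 / (n%:R - 1)))))%R]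
         <= (Num.sqrt 2 * p%:R `^ (1 / (n%:R - 1))
             * expR (- (1 / 2) * delta * (n%:R - 1)
                     * (p%:R `^ (2 / (n%:R - 1)) - 1))
             / Num.sqrt (pi * (1 + delta) * (n%:R - 1)
                         * (p%:R `^ (2 / (n%:R - 1)) - 1)))%:E)%E,
      forall delta : R, 0 < delta ->
        (fun p : nat => ereal_sup
           [set P p n [set t | M p n t >
              Num.sqrt ((1 + delta) * (1 - p%:R `^ (- 2 / (n%:R - 1))))]
           | n in [set n : nat | (2 <= n)%N]]) @ \oo --> 0%E
    & (fun pn : nat * nat => P pn.1 pn.2 [set t | M pn.1 pn.2 t <=
           Num.sqrt (1 - pn.1%:R `^ (- 2 / (pn.2%:R - 1)))])
        @ filter_prod \oo \oo --> 1%E].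
Proof.
move=> M; pose thr p n (delta : R) : R :=
  Num.sqrt ((1 + delta) * (1 - p%:R `^ (- 2 / (n%:R - 1)))).
have tail p n delta : (2 <= p)%N -> (2 <= n)%N -> 0 <= delta ->
    (P p n [set t | (thr p n delta < M p n t)%R] <=
     (coherence_bound n.-1 delta (p%:R `^ (1 / (n%:R - 1))))%:E)%E.
  case: n => [|[|n]]// p2 n2 d0; rewrite /thr -[n.+2%:R]natr1 addrK.
  rewrite powR_rootXN2//; have w1 := powR_root_gt1 (R := R) p2 (ltn0Sn n).
  have w0 := lt_trans ltr01 w1.
  have b0 : 0 < (1 + delta) * (1 - (p%:R `^ (1 / n.+1%:R)) ^- 2).
    rewrite mulr_gt0//; first by rewrite ltr_wpDr.
    by rewrite subr_gt0 invf_lt1 ?exprn_gt0// expr_gt1// ltW.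
  have := probability_max_abs_dot (U_unif _ _ p2 n2) (L_unit _ _ p2 n2)
    (_ : 0 < Num.sqrt ((1 + delta) * (1 - (p%:R `^ (1 / n.+1%:R)) ^- 2))).
  rewrite sqrtr_gt0 => /(_ b0) /le_trans; apply.
  have := cap_bound_le (ltn0Sn n) d0 w1.
  by rewrite (powR_rootX _ (ltn0Sn n)) lee_fin.
(* This weaker bound no longer contains the root of p; its exponential is p^(-delta). *)
pose rate p n (delta : R) : R := Num.sqrt ((ln p%:R)^-1 / 2 + (n%:R - 1)^-1) *
  expR (- delta * ln p%:R).
have tail_rate p n delta : (2 <= p)%N -> (2 <= n)%N -> 0 <= delta ->
    (P p n [set t | (thr p n delta < M p n t)%R] <= (rate p n delta)%:E)%E.
  move=> p2 n2 d0; apply: le_trans (tail _ _ _ p2 n2 d0) _.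
  case: n n2 => [|[|n]]// _; rewrite lee_fin /rate -[n.+2%:R]natr1 addrK.
  have := coherence_bound_le (ltn0Sn n) d0 (powR_root_gt1 p2 (ltn0Sn n)).
  by rewrite (powR_rootX _ (ltn0Sn n)).
split.
- move=> p n p2 n2 delta d0; apply: le_trans (tail _ _ _ p2 n2 (ltW d0)) _.
  case: n n2 => [|[|n]]// _; rewrite -[n.+2%:R]natr1 addrK.
  by rewrite /coherence_bound powR_rootX2.
- move=> delta d0.
  (* A majorant free of n: 1 / (n - 1) is at most 1, and exp(-x) <= 1 / x is applied at x = delta ln
     p. *)
  pose h p : R := Num.sqrt ((ln p%:R)^-1 / 2 + 1) * (delta^-1 * (ln p%:R)^-1).
  apply: (@squeeze_cvge _ _ _ _ (cst 0%E) _ (fun p => (h p)%:E)).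
  + near=> p; have p2 : (2 <= p)%N by near: p; exact: nbhs_infty_ge.
    have lp : 0 < ln (p%:R : R) by rewrite ln_gt0// ltr1n.
    apply/andP; split.
      (* The supremum is nonnegative because it dominates the probability at n = 2. *)
      apply: le_trans (ereal_sup_ubound _); last by exists 2%N.
      exact: measure_ge0.
    apply: ge_ereal_sup => _ /= [n n2 <-].
    apply: le_trans (tail_rate _ _ _ p2 n2 (ltW d0)) _.
    rewrite lee_fin ler_pM ?sqrtr_ge0 ?expR_ge0//.
      rewrite ler_wsqrtr// lerD2l invf_le1 ?subr_gt0 ?ltr1n// lerBrDr.
      by rewrite (ler_nat R 2).
    rewrite mulNr expRN -invfM lef_pV2 ?posrE ?expR_gt0 ?mulr_gt0//.
    by rewrite (le_trans _ (expR_ge1Dx _))// lerDr.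
  + exact: cvg_cst.
  + apply: cvg_EFin; first exact: nearW.
    rewrite -[X in _ --> X](mulr0 (Num.sqrt (0 / 2 + 1))).
    apply: cvgM; last first.
      by rewrite -[X in _ --> X](mulr0 delta^-1); apply: cvgMr; exact: cvg_lnV.
    apply: continuous_cvg; first exact: sqrt_continuous.
    by apply: cvgD; [apply: cvgMl; exact: cvg_lnV|exact: cvg_cst].
(* At delta = 0 the exponential equals 1, so the decay comes from the square root alone, which needs
   both p and n to grow. *)
- have rate0 p n : rate p n 0 = Num.sqrt ((ln p%:R)^-1 / 2 + (n%:R - 1)^-1).
    by rewrite /rate oppr0 mul0r expR0 mulr1.
  apply: (@squeeze_cvge _ _ _ _ (fun pn : nat * nat => (1 -
    Num.sqrt ((ln pn.1%:R)^-1 / 2 + (pn.2%:R - 1)^-1))%:E) _ (cst 1%E)).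
  + exists ([set p | (2 <= p)%N], [set n | (2 <= n)%N]) => /=.
      split; exact: nbhs_infty_ge.
    move=> [p n] /= [p2 n2].
    have thrE : thr p n 0 = Num.sqrt (1 - p%:R `^ (- 2 / (n%:R - 1))).
      by rewrite /thr addr0 mul1r.
    have mE : measurable [set t | thr p n 0 < M p n t].
      by apply: measurable_max_abs_dot_gt; exact: sqrtr_ge0.
    (* Passing to the complement turns the tail estimate into a lower bound for this probability. *)
    have -> : [set t | M p n t <= Num.sqrt (1 - p%:R `^ (- 2 / (n%:R - 1)))] =
        ~` [set t | thr p n 0 < M p n t].
      apply/seteqP; split => t /=; rewrite thrE; first by rewrite leNgt => /negP.
      by move/negP; rewrite -leNgt.
    rewrite probability_le1 ?andbT; last exact: measurableC.
    rewrite probability_setC// EFinB leeB// -rate0.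
    exact: tail_rate.
  + apply: cvg_EFin; first exact: nearW.
    rewrite -[X in _ --> X]subr0 -(sqrtr0 R) -[X in Num.sqrt X](addr0 0).
    apply: cvgB; first exact: cvg_cst.
    apply: continuous_cvg; first exact: sqrt_continuous.
    (* Each summand depends on one index only, so its limit follows through the corresponding
       projection of the product filter, whatever the relative rates. *)
    apply: cvgD.
      rewrite -[X in _ --> X](mul0r (2^-1)); apply: cvgMl.
      exact: (cvg_comp _ _ cvg_fst cvg_lnV).
    exact: (cvg_comp _ _ cvg_snd cvg_predV).
  + exact: cvg_cst.
Unshelve. all: end_near. Qed.
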